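(* Let $(A,\cdot,[-,-,-],\varepsilon)$ and $(A',\cdot',[-,-,-]',\varepsilon)$ be two non-commutative ternary Leibniz-Nambu-Poisson color algebras (with the same grading group $G$ and the same bicharacter $\varepsilon$). Then $A\oplus A'$ is a non-commutative ternary Leibniz-Nambu-Poisson color algebra (with bicharacter $\varepsilon$) with respect to the componentwise operations $$(x\oplus x')\ast(y\oplus y'):=(x\cdot y)\oplus(x'\cdot' y'),$$ $$\{x\oplus x',y\oplus y',z\oplus z'\}:=[x,y,z]\oplus[x',y',z']',$$ for $x,y,z\in A$ and $x',y',z'\in A'$, where $A\oplus A'$ is graded by $(A\oplus A')_a=A_a\oplus A'_a$, $a\in G$.
   Context: $\mathbb{K}$ is a field of characteristic different from 2 and $G$ is an abelian group. A bicharacter is a map $\varepsilon:G\times G\to\mathbb{K}^*$ with $\varepsilon(a,b)\varepsilon(b,a)=1$, $\varepsilon(a,b+c)=\varepsilon(a,b)\varepsilon(a,c)$, $\varepsilon(a+b,c)=\varepsilon(a,c)\varepsilon(b,c)$. For a $G$-graded vector space $V=\bigoplus_{a\in G}V_a$ over $\mathbb{K}$, $\mathcal{H}(V)$ denotes the set of homogeneous elements. For homogeneous $x,y,z$ one writes $\varepsilon(x,y)$ for $\varepsilon(\deg x,\deg y)$, $\varepsilon(x,y+z)$ for $\varepsilon(\deg x,\deg y+\deg z)$, etc. A multilinear map is even if the degree of its value on homogeneous elements is the sum of their degrees. A non-commutative ternary Leibniz-Nambu-Poisson color algebra is a quadruple $(A,\cdot,[-,-,-],\varepsilon)$, with $A$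 a $G$-graded vector space, $\cdot$ even bilinear, $[-,-,-]$ even trilinear and $\varepsilon$ a bicharacter, such that: 1) $(A,\cdot,\varepsilon)$ is an associative color algebra, i.e. $(x\cdot y)\cdot z=x\cdot(y\cdot z)$; 2) $(A,[-,-,-],\varepsilon)$ is a ternary Leibniz color algebra, i.e. $[[x,y,z],t,u]=[x,y,[z,t,u]]+\varepsilon(z,t+u)[x,[y,t,u],z]+\varepsilon(y+z,t+u)[[x,t,u],y,z]$; 3) $[x\cdot y,z,t]=x\cdot[y,z,t]+\varepsilon(y,z+t)[x,z,t]\cdot y$; for all $x,y,z,t,u\in\mathcal{H}(A)$. *)

(* Defs.v *)
From mathcomp Require Import all_boot all_order all_algebra.

Set Implicit Arguments.
Unset Strict Implicit.
Unset Printing Implicit Defensive.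

Import GRing.Theory.
Local Open Scope ring_scope.

Record is_bicharacter (K : fieldType) (G : zmodType) (eps : G -> G -> K) :
  Prop := IsBicharacter {
  bichar_neq0 : forall a b, eps a b != 0;
  bichar_skew : forall a b, eps a b * eps b a = 1;
  bicharDr : forall a b c, eps a (b + c) = eps a b * eps a c;
  bicharDl : forall a b c, eps (a + b) c = eps a c * eps b c
}.

(* [V_ a x] means that x lies in the component of degree a; the last two      *)
(* fields say that V is the internal direct sum of its components.  G may be  *)
(* infinite, so sums range over finite duplicate-free sequences of degrees.   *)
Record is_grading (K : fieldType) (G : zmodType) (V : lmodType K)
    (V_ : G -> V -> Prop) : Prop := IsGrading {
  grading0 : forall a, V_ a 0;
  grading_linear : forall a (k : K) x y,
    V_ a x -> V_ a y -> V_ a (k *: x + y);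
  grading_span : forall x, exists (s : seq G) (c : G -> V),
    [/\ uniq s, forall a, a \in s -> V_ a (c a) & x = \sum_(a <- s) c a];
  grading_indep : forall (s : seq G) (c : G -> V),
    uniq s -> (forall a, a \in s -> V_ a (c a)) ->
    \sum_(a <- s) c a = 0 -> forall a, a \in s -> c a = 0
}.

Section Multilinear.
Variables (K : fieldType) (V : lmodType K).

Definition is_bilinear (f : V -> V -> V) : Prop :=
  (forall y, linear (f ^~ y)) /\ (forall x, linear (f x)).

Definition is_trilinear (f : V -> V -> V -> V) : Prop :=
  [/\ forall y z, linear (fun x => f x y z),
      forall x z, linear (fun y => f x y z)
    & forall x y, linear (fun z => f x y z)].

End Multilinear.

Section ColorAlgebras.
Variables (K : fieldType) (G : zmodType) (A : lmodType K).
Variables (A_ : G -> A -> Prop) (mul : A -> A -> A) (br : A -> A -> A -> A).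
Variable eps : G -> G -> K.

Definition even2 : Prop :=
  forall a b x y, A_ a x -> A_ b y -> A_ (a + b) (mul x y).

Definition even3 : Prop :=
  forall a b c x y z, A_ a x -> A_ b y -> A_ c z ->
    A_ (a + b + c) (br x y z).

(* Identities on homogeneous elements quantify over all degrees witnessing    *)
(* homogeneity: the degree is unique except for 0, at which every identity    *)
(* below is trivial by multilinearity.                                        *)

Record is_assoc_color_algebra : Prop := IsAssocColorAlgebra {
  assoc_grading : is_grading A_;
  assoc_bichar : is_bicharacter eps;
  assoc_bilinear : is_bilinear mul;
  assoc_even : even2;
  assoc_mulA : forall a b c x y z, A_ a x -> A_ b y -> A_ c z ->
    mul (mul x y) z = mul x (mul y z)
}.

Record is_ternary_Leibniz_color_algebra : Prop :=
  IsTernaryLeibnizColorAlgebra {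
  leibniz_grading : is_grading A_;
  leibniz_bichar : is_bicharacter eps;
  leibniz_trilinear : is_trilinear br;
  leibniz_even : even3;
  leibniz_identity : forall (dx dy dz dt du : G) (x y z t u : A),
    A_ dx x -> A_ dy y -> A_ dz z -> A_ dt t -> A_ du u ->
    br (br x y z) t u =
      br x y (br z t u)
      + eps dz (dt + du) *: br x (br y t u) z
      + eps (dy + dz) (dt + du) *: br (br x t u) y z
}.

Record is_nc_ternary_LNP_color_algebra : Prop := IsNCTernaryLNPColorAlgebra {
  LNP_assoc : is_assoc_color_algebra;
  LNP_leibniz : is_ternary_Leibniz_color_algebra;
  LNP_compat : forall (dx dy dz dt : G) (x y z t : A),
    A_ dx x -> A_ dy y -> A_ dz z -> A_ dt t ->
    br (mul x y) z t =
      mul x (br y z t) + eps dy (dz + dt) *: mul (br x z t) y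
}.

End ColorAlgebras.

Section DirectSum.
Variables (K : fieldType) (G : zmodType) (A A' : lmodType K).

Definition dsum_grading (A_ : G -> A -> Prop) (A'_ : G -> A' -> Prop)
    (a : G) (u : A * A') : Prop := A_ a u.1 /\ A'_ a u.2.

Definition dsum_mul (mul : A -> A -> A) (mul' : A' -> A' -> A')
    (u v : A * A') : A * A' := (mul u.1 v.1, mul' u.2 v.2).

Definition dsum_br (br : A -> A -> A -> A) (br' : A' -> A' -> A' -> A')
    (u v w : A * A') : A * A' := (br u.1 v.1 w.1, br' u.2 v.2 w.2).

End DirectSum.

(* Main.v *)
Require Import Defs.
From mathcomp Require Import all_boot all_order all_algebra.

Set Implicit Arguments.
Unset Strict Implicit.
Unset Printing Implicit Defensive.

Import GRing.Theory.
Local Open Scope ring_scope.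

(** Both coordinates of a homogeneous element of degree [a] are homogeneous of
    degree [a], and every operation is computed coordinatewise. Hence each
    identity on the direct sum splits into the same identity in [A] and in
    [A'], with the same degrees; since the two algebras share [eps], the
    scalars are the same too. Multilinearity and evenness split in this way as
    well.

    The one step that is not coordinatewise is the existence of homogeneous
    decompositions ([dsum_is_grading]): the decompositions of [x] and of [x']
    are indexed by two unrelated finite sets of degrees, and have to be
    extended by zero to their union ([sum_pad]) before they can be paired. *)

Definition pad (I : eqType) (V : zmodType) (s : seq I) (c : I -> V) (a : I) : V :=
  if a \in s then c a else 0.

(** A decomposition into homogeneous components may be indexed by any larger
    duplicate-free set of degrees. *)
Lemma sum_pad (I : eqType) (V : zmodType) (s s' : seq I) (c : I -> V) :
  uniq s -> uniq s' -> {subset s <= s'} ->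
  \sum_(a <- s') pad s c a = \sum_(a <- s) c a.
Proof.
move=> us us' ss'; rewrite /pad -big_mkcond -big_filter.
apply: perm_big; apply: uniq_perm => //; first exact: filter_uniq.
by move=> a; rewrite mem_filter; case: (boolP (a \in s)) => // /ss'.
Qed.

Lemma pad_homogeneous (K : fieldType) (G : zmodType) (V : lmodType K)
    (V_ : G -> V -> Prop) (s : seq G) (c : G -> V) :
  is_grading V_ -> (forall a, a \in s -> V_ a (c a)) ->
  forall a, V_ a (pad s c a).
Proof.
move=> gV Vc a; rewrite /pad.
by case: (boolP (a \in s)) => [/Vc // | _]; apply: grading0 gV a.
Qed.

Lemma sum_pair (I : Type) (V V' : zmodType) (s : seq I)
    (c : I -> V) (c' : I -> V') :
  \sum_(a <- s) (c a, c' a) = (\sum_(a <- s) c a, \sum_(a <- s) c' a).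
Proof. by elim/big_rec3: _ => // a x y z _ ->. Qed.

Section DirectSum.
Variables (K : fieldType) (G : zmodType) (eps : G -> G -> K).
Variables (A A' : lmodType K) (A_ : G -> A -> Prop) (A'_ : G -> A' -> Prop).

(** Spanning uses decompositions over a common set of degrees; independence
    holds because a sum of pairs vanishes only if both coordinate sums do, so
    that independence in each summand kills the corresponding coordinate. *)
Lemma dsum_is_grading :
  is_grading A_ -> is_grading A'_ ->
  @is_grading K G (A * A')%type (dsum_grading A_ A'_).
Proof.
move=> gA gA'; split.
- by move=> a; split; [apply: grading0 gA a | apply: grading0 gA' a].
- move=> a k x y [Ax A'x] [Ay A'y].
  by split; [apply: (grading_linear gA) | apply: (grading_linear gA')].
- move=> [x x'].
  have [s [c [us Ac ->]]] := grading_span gA x.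
  have [s' [c' [us' A'c' ->]]] := grading_span gA' x'.
  exists (undup (s ++ s')), (fun a => (pad s c a, pad s' c' a)).
  split=> [|a _|]; first exact: undup_uniq.
  + by split; apply: pad_homogeneous.
  + rewrite sum_pair !sum_pad ?undup_uniq // => a sa;
      by rewrite mem_undup mem_cat sa ?orbT.
- move=> s c us Ac sc0 a sa.
  have: \sum_(b <- s) ((c b).1, (c b).2) = 0.
    by rewrite -[RHS]sc0; apply: eq_bigr => b _; case: (c b).
  rewrite sum_pair => -[c1 c2].
  have c1a := grading_indep gA us (fun b sb => (Ac b sb).1) c1 sa.
  have c2a := grading_indep gA' us (fun b sb => (Ac b sb).2) c2 sa.
  by rewrite [c a]surjective_pairing c1a c2a.
Qed.

Lemma dsum_is_bilinear (mul : A -> A -> A) (mul' : A' -> A' -> A') :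
  is_bilinear mul -> is_bilinear mul' ->
  @is_bilinear K (A * A')%type (dsum_mul mul mul').
Proof.
move=> [ml mr] [ml' mr'].
split=> u k v w; rewrite /dsum_mul /=.
- by rewrite ml ml'.
- by rewrite mr mr'.
Qed.

Lemma dsum_is_trilinear (br : A -> A -> A -> A) (br' : A' -> A' -> A' -> A') :
  is_trilinear br -> is_trilinear br' ->
  @is_trilinear K (A * A')%type (dsum_br br br').
Proof.
move=> [b1 b2 b3] [b1' b2' b3'].
split=> u v k w t; rewrite /dsum_br /=.
- by rewrite b1 b1'.
- by rewrite b2 b2'.
- by rewrite b3 b3'.
Qed.

Lemma dsum_is_assoc_color_algebra
    (mul : A -> A -> A) (mul' : A' -> A' -> A') :
  is_assoc_color_algebra A_ mul eps -> is_assoc_color_algebra A'_ mul' eps ->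
  @is_assoc_color_algebra K G (A * A')%type
    (dsum_grading A_ A'_) (dsum_mul mul mul') eps.
Proof.
move=> [gA heps bA eA mA] [gA' _ bA' eA' mA']; split=> //.
- exact: dsum_is_grading.
- exact: dsum_is_bilinear.
- by move=> a b x y [? ?] [? ?]; split; [apply: eA | apply: eA'].
- move=> a b c x y z [Ax A'x] [Ay A'y] [Az A'z].
  by congr pair; [apply: mA Ax Ay Az | apply: mA' A'x A'y A'z].
Qed.

Lemma dsum_is_ternary_Leibniz_color_algebra
    (br : A -> A -> A -> A) (br' : A' -> A' -> A' -> A') :
  is_ternary_Leibniz_color_algebra A_ br eps ->
  is_ternary_Leibniz_color_algebra A'_ br' eps ->
  @is_ternary_Leibniz_color_algebra K G (A * A')%type
    (dsum_grading A_ A'_) (dsum_br br br') eps.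
Proof.
move=> [gA heps tA eA lA] [gA' _ tA' eA' lA']; split=> //.
- exact: dsum_is_grading.
- exact: dsum_is_trilinear.
- by move=> a b c x y z [? ?] [? ?] [? ?]; split; [apply: eA | apply: eA'].
- move=> dx dy dz dt du x y z t u [Ax A'x] [Ay A'y] [Az A'z] [At A't] [Au A'u].
  by congr pair; [apply: lA Ax Ay Az At Au | apply: lA' A'x A'y A'z A't A'u].
Qed.

End DirectSum.

Theorem proposition4p3 (K : fieldType) (hK : 2%N \notin [pchar K])
    (G : zmodType) (eps : G -> G -> K) (A A' : lmodType K)
    (A_ : G -> A -> Prop) (A'_ : G -> A' -> Prop)
    (mul : A -> A -> A) (mul' : A' -> A' -> A')
    (br : A -> A -> A -> A) (br' : A' -> A' -> A' -> A')
    (hA : is_nc_ternary_LNP_color_algebra A_ mul br eps)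
    (hA' : is_nc_ternary_LNP_color_algebra A'_ mul' br' eps) :
  @is_nc_ternary_LNP_color_algebra K G (A * A')%type
    (dsum_grading A_ A'_) (dsum_mul mul mul') (dsum_br br br') eps.
Proof.
case: hA hA' => [aA lA cA] [aA' lA' cA']; split.
- exact: dsum_is_assoc_color_algebra.
- exact: dsum_is_ternary_Leibniz_color_algebra.
- move=> dx dy dz dt x y z t [Ax A'x] [Ay A'y] [Az A'z] [At A't].
  by congr pair; [apply: cA Ax Ay Az At | apply: cA' A'x A'y A'z A't].
Qed.
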